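(* Let $X,U,V$ be Banach spaces, let $A:D(A)\subset X\to X$ generate a $C_0$-semigroup $T=(T(t))_{t\ge 0}$ on $X$, let $B\in L(U,X_{-1})$, $B_2\in L(V,X_{-1})$ and $f:X\times U\to V$. Assume: (a) $B$ is $\infty$-admissible for $T$, and the map $(t,u)\mapsto \Phi(t)u:=\int_0^tT_{-1}(t-s)Bu(s)\,ds$ is continuous from $\mathbb{R}_+\times L^\infty(\mathbb{R}_+,U)$ to $X$; (b) $B_2$ is zero-class $\infty$-admissible for $T$, and for all $u\in L^\infty(\mathbb{R}_+,U)$ and all $x\in C(\mathbb{R}_+,X)$ the map $s\mapsto f(x(s),u(s))$ is in $L^\infty_{loc}(\mathbb{R}_+,V)$; (c) for every $C>0$ there is $L(C)>0$ with $\|f(y,v)-f(x,v)\|_V\le L(C)\|y-x\|_X$ for all $x,y\in X$ with $\|x\|_X,\|y\|_X<C$ and all $v\in U$ with $\|v\|_U<C$; $f(x,\cdot)$ is continuous for every $x\in X$; and there are $\sigma\in\mathcal{K}_\infty$, $c>0$ with $\|f(0,u)\|_V\le\sigma(\|u\|_U)+c$ for all $u\in U$. Let $\phi$ be the flow of $\dot x(t)=Ax(t)+B_2f(x(t),u(t))+Bu(t)$, $x(0)=x_0$, with inputs in $\mathcal{U}:=L^\infty(\mathbb{R}_+,U)$. Suppose that the system is forward complete ($t_m(x,u)=\infty$ for all $(x,u)\in X\times\mathcal{U}$) and has bounded reachability sets, i.e. for any $C>0$, $\tau>0$: $\sup\{\|\phi(t,x,u)\|_X:\|x\|_X\le C,\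 \|u\|_{\mathcal{U}}\le C,\ t\in[0,\tau]\}<\infty$. Then the flow is Lipschitz continuous on compact intervals for uniformly bounded inputs: for any $\tau>0$ and any $C>0$ there exists $L>0$ such that for all $x_1,x_2\in X$ with $\|x_1\|_X,\|x_2\|_X\le C$ and all $u\in\mathcal{U}$ with $\|u\|_{\mathcal{U}}<C$ $$\|\phi(t,x_1,u)-\phi(t,x_2,u)\|_X\le L\|x_1-x_2\|_X,\qquad t\in[0,\tau].$$
   Context: $\mathcal{K}_\infty$ is the set of continuous, strictly increasing, unbounded $\gamma:\mathbb{R}_+\to\mathbb{R}_+$ with $\gamma(0)=0$. $X_{-1}$ is the completion of $X$ in the norm $x\mapsto\|(aI-A)^{-1}x\|_X$ with some $a\in\rho(A)$; $T$ extends uniquely to a $C_0$-semigroup $T_{-1}=(T_{-1}(t))_{t\ge0}$ on $X_{-1}$. $L^\infty_{loc}(\mathbb{R}_+,Y)$: strongly measurable functions $\mathbb{R}_+\to Y$ that are essentially bounded on every $[0,t]$. An operator $B\in L(U,X_{-1})$ is $\infty$-admissible for $T$ if there is $t>0$ such that $\int_0^tT_{-1}(t-s)Bu(s)\,ds\in X$ for all $u\in L^\infty_{loc}(\mathbb{R}_+,U)$. Equivalently (known fact), for every $t>0$ there is $h_t>0$ such that for all $u\in L^\infty_{loc}(\mathbb{R}_+,U)$ this integral lies in $X$ and has $X$-norm at most $h_t\|u\|_{L^\infty([0,t],U)}$; $t\mapsto h_t$ is assumed (without loss of generality) nondecreasing. $B$ is zero-class $\infty$-admissible if the constants can be chosen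 with $\lim_{t\to+0}h_t=0$. The same definitions apply to $B_2$ with $V$ in place of $U$. A mild solution on $[0,\tau]$ is a function $x\in C([0,\tau],X)$ such that for all $t\in[0,\tau]$ $$x(t)=T(t)x_0+\int_0^tT_{-1}(t-s)B_2f(x(s),u(s))\,ds+\int_0^tT_{-1}(t-s)Bu(s)\,ds,$$ with Bochner integrals of $X_{-1}$-valued maps. A function on $[0,t_1)$ is a mild solution if its restriction to $[0,\tau]$ is one for every $\tau\in(0,t_1)$; a mild solution is maximal if it cannot be extended to a mild solution (same $x_0,u$) on a larger interval. Under (a)–(c), for every $x_0\in X$, $u\in\mathcal{U}$ there is a unique maximal mild solution, denoted $\phi(\cdot,x_0,u):[0,t_m(x_0,u))\to X$, $0<t_m(x_0,u)\le\infty$; $\phi$ is called the flow. *)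

(* Defs.v *)
From HB Require Import structures.
From mathcomp Require Import all_boot all_order all_algebra.
From mathcomp Require Import all_classical all_reals all_analysis.
From mathcomp Require Import ess_sup_inf.

Set Implicit Arguments.
Unset Strict Implicit.
Unset Printing Implicit Defensive.

Import Order.TTheory GRing.Theory Num.Theory.
Import numFieldNormedType.Exports.

Local Open Scope classical_set_scope.
Local Open Scope ring_scope.

Section StrongMeasurability.
Context {R : realType} {Y : completeNormedModType R}.
Implicit Types (g s u : R -> Y) (D : set R).

Definition simple_function s : Prop :=
  finite_set (range s) /\
  forall y, measurable (s @^-1` [set y] : set (measurableTypeR R)).

(* The approximation is only required almost everywhere, so simple functions
   over Borel sets yield the same functions as simple functions over
   Lebesgue-measurable sets. *)
Definition strongly_measurable D g : Prop :=
  exists2 s : nat -> R -> Y, (forall n, simple_function (s n)) &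
    {ae lebesgue_measure, forall r, D r -> s n r @[n --> \oo] --> g r}.

Definition simple_integral (t : R) s : Y :=
  \sum_(y \in range s)
    fine (lebesgue_measure (`[0, t]%classic `&` s @^-1` [set y])) *: y.

(* [bochner_integral t g v]: g is Bochner integrable on [0, t] with respect to
   the Lebesgue measure, and its integral is v. *)
Definition bochner_integral (t : R) g (v : Y) : Prop :=
  strongly_measurable `[0, t] g /\
  exists s : nat -> R -> Y,
    [/\ forall n, simple_function (s n),
        (\int[lebesgue_measure]_(r in `[0%R, t]) (`|g r - s n r|)%:E
           @[n --> \oo] --> 0)%E
      & simple_integral t (s n) @[n --> \oo] --> v].

(* Extending by 0 outside D leaves the essential supremum of the norm over D
   unchanged, and gives the value 0 when D is a null set. *)
Definition Linf_norm D u : \bar R :=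
  ess_sup lebesgue_measure (fun r => (`|(u \_ D) r|)%:E).

(* Elements of L^oo are represented by functions on R of which only the
   restriction to [0, +oo[ matters; such functions are not quotiented by
   almost everywhere equality. *)
Definition Linf_loc u : Prop :=
  strongly_measurable `[0, +oo[ u /\
  forall t : R, 0 <= t -> (Linf_norm `[0%R, t] u < +oo)%E.

Definition Linf u : Prop :=
  strongly_measurable `[0, +oo[ u /\ (Linf_norm `[0%R, +oo[ u < +oo)%E.

End StrongMeasurability.

Section Semigroups.
Context {R : realType}.

(* Only the values T t with 0 <= t are meaningful. *)
Definition C0_semigroup (X : completeNormedModType R)
    (T : R -> {linear X -> X}) : Prop :=
  [/\ forall t : R, 0 <= t -> continuous (T t),
      forall x, T 0 x = x,
      forall (t s : R) x, 0 <= t -> 0 <= s -> T (t + s) x = T t (T s x)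
    & forall x, T t x @[t --> 0^'+] --> x].

(* The operator with domain DA and values A (arbitrary outside DA) is the
   infinitesimal generator of T. *)
Definition generates (X : completeNormedModType R)
    (DA : set X) (A : X -> X) (T : R -> {linear X -> X}) : Prop :=
  C0_semigroup T /\
  forall x y : X, (DA x /\ A x = y) <->
    h^-1 *: (T h x - x) @[h --> 0^'+] --> y.

(* a belongs to the resolvent set of A, and Ra = (aI - A)^-1. *)
Definition resolvent (X : completeNormedModType R)
    (DA : set X) (A : X -> X) (a : R) (Ra : {linear X -> X}) : Prop :=
  [/\ continuous Ra,
      forall x, DA (Ra x) /\ a *: Ra x - A (Ra x) = x
    & forall x, DA x -> Ra (a *: x - A x) = x].

(* i identifies X with a dense subspace of the Banach space Xm1, whose norm
   restricts on X to |(aI - A)^-1 x|. *)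
Definition extrapolation_space (X Xm1 : completeNormedModType R)
    (Ra : {linear X -> X}) (i : {linear X -> Xm1}) : Prop :=
  (forall x, `|i x| = `|Ra x|) /\ dense (range i).

Definition extends_semigroup (X Xm1 : completeNormedModType R)
    (i : {linear X -> Xm1}) (T : R -> {linear X -> X})
    (Tm1 : R -> {linear Xm1 -> Xm1}) : Prop :=
  C0_semigroup Tm1 /\ forall (t : R) x, 0 <= t -> Tm1 t (i x) = i (T t x).

End Semigroups.

Section Admissibility.
Context {R : realType} {X Xm1 W : completeNormedModType R}.
Variables (i : {linear X -> Xm1}) (Tm1 : R -> {linear Xm1 -> Xm1}).
Variable (B : {linear W -> Xm1}).

(* z is the integral of T_{-1}(t - s) B w(s) over s in [0, t]. *)
Definition convolution (t : R) (w : R -> W) (z : Xm1) : Prop :=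
  bochner_integral t (fun s => Tm1 (t - s) (B (w s))) z.

Definition infty_admissible : Prop :=
  exists2 t : R, 0 < t &
    forall w : R -> W, Linf_loc w -> exists x : X, convolution t w (i x).

Definition input_map_continuous : Prop :=
  exists Phi : R -> (R -> W) -> X,
    (forall (t : R) w, 0 <= t -> Linf w -> convolution t w (i (Phi t w))) /\
    (forall (t : R) w, 0 <= t -> Linf w -> forall e : R, 0 < e ->
       exists2 d : R, 0 < d & forall (t' : R) w', 0 <= t' -> Linf w' ->
         `|t' - t| < d ->
         (Linf_norm `[0%R, +oo[ (fun s => w' s - w s)%R < d%:E)%E ->
         `|Phi t' w' - Phi t w| < e).

Definition zero_class_infty_admissible : Prop :=
  exists h : R -> R,
    [/\ forall t : R, 0 < t -> 0 < h t,
        forall t t' : R, 0 < t -> t <= t' -> h t <= h t',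
        forall (t : R) w, 0 < t -> Linf_loc w -> exists2 x : X,
          convolution t w (i x) &
          (`|x|%:E <= (h t)%:E * Linf_norm `[0%R, t] w)%E
      & h t @[t --> 0^'+] --> 0].

End Admissibility.

Definition class_Kinfty {R : realType} (g : R -> R) : Prop :=
  [/\ {within `[0, +oo[, continuous g},
      forall r s : R, 0 <= r -> r < s -> g r < g s,
      forall M : R, exists2 r : R, 0 <= r & M < g r
    & g 0 = 0].

Section MildSolutions.
Context {R : realType} {X Xm1 U V : completeNormedModType R}.
Variables (i : {linear X -> Xm1}) (T : R -> {linear X -> X}).
Variable Tm1 : R -> {linear Xm1 -> Xm1}.
Variables (B : {linear U -> Xm1}) (B2 : {linear V -> Xm1}).
Variable f : X -> U -> V.

Definition mild_solution (x0 : X) (u : R -> U) (tau : R) (x : R -> X) : Prop :=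
  {within `[0, tau], continuous x} /\
  forall t : R, 0 <= t <= tau -> exists z2 z,
    [/\ convolution Tm1 B2 t (fun s => f (x s) (u s)) z2,
        convolution Tm1 B t u z
      & i (x t) = i (T t x0) + z2 + z].

Definition mild_solution_upto (x0 : X) (u : R -> U) (t1 : \bar R)
    (x : R -> X) : Prop :=
  forall tau : R, 0 < tau -> (tau%:E < t1)%E -> mild_solution x0 u tau x.

(* An interval larger than [0, t1[ contains [0, tau] for some tau >= t1. *)
Definition maximal_mild_solution (x0 : X) (u : R -> U) (t1 : \bar R)
    (x : R -> X) : Prop :=
  [/\ (0 < t1)%E, mild_solution_upto x0 u t1 x
    & ~ exists tau y, [/\ (t1 <= tau%:E)%E, mild_solution x0 u tau y
        & forall t : R, 0 <= t -> (t%:E < t1)%E -> y t = x t]].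

Definition is_flow (tm : X -> (R -> U) -> \bar R)
    (phi : X -> (R -> U) -> R -> X) : Prop :=
  forall x0 u, Linf u -> maximal_mild_solution x0 u (tm x0 u) (phi x0 u).

End MildSolutions.

Definition forward_complete {R : realType} {X U : completeNormedModType R}
    (tm : X -> (R -> U) -> \bar R) : Prop :=
  forall x u, Linf u -> tm x u = +oo%E.

Definition bounded_reachability_sets {R : realType}
    {X U : completeNormedModType R} (phi : X -> (R -> U) -> R -> X) : Prop :=
  forall C tau : R, 0 < C -> 0 < tau ->
    has_ubound [set r | exists (x : X) (u : R -> U) (t : R),
      [/\ `|x| <= C, Linf u, (Linf_norm `[0%R, +oo[ u <= C%:E)%E,
          0 <= t <= tau & r = `|phi x u t|]].

(* Main.v *)
Require Import Defs.
From HB Require Import structures.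
From mathcomp Require Import all_boot all_order all_algebra.
From mathcomp Require Import all_classical all_reals all_analysis.
From mathcomp Require Import ring lra finmap measurable_realfun ess_sup_inf.

(** The difference of two mild solutions with the same input is
    T(t)(x1 - x2) plus the convolution of w = f(phi1, u) - f(phi2, u), since the
    term B u cancels. Bounded reachability keeps both solutions in a ball fixed
    in advance, so |w| <= L |phi1 - phi2| there. Choose a step t0 with
    h(t0) L <= 1/2. For t in [k t0, (k+1) t0], cut w at k t0: the early part
    contributes at most h(tau) L sup_[0, k t0] |phi1 - phi2|; the late part,
    translated to the origin, contributes at most
    h(t0) L sup_[k t0, t] |phi1 - phi2|, which is absorbed in the left-hand side.
    Finitely many steps cover [0, tau]. *)

Set Implicit Arguments.
Unset Strict Implicit.
Unset Printing Implicit Defensive.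

Import Order.TTheory GRing.Theory Num.Theory.
Import numFieldNormedType.Exports.

Local Open Scope classical_set_scope.
Local Open Scope ring_scope.

(** * Monotonicity of the integral without measurability *)

Section IntegralOfArbitraryFunctions.
Local Open Scope ereal_scope.
Context d (T : measurableType d) (R : realType).
Variable mu : {measure set T -> \bar R}.
Import HBNNSimple.

(* No measurability, since g in bochner_integral is only almost everywhere a
   limit of simple functions: the integral is a supremum over simple minorants,
   and a minorant may be set to 0 on the exceptional null set. *)
Lemma ae_le_integral_ge0 (D : set T) (f g : T -> \bar R) : measurable D ->
  (forall x, D x -> 0 <= f x) -> (forall x, D x -> 0 <= g x) ->
  {ae mu, forall x, D x -> f x <= g x} ->
  \int[mu]_(x in D) f x <= \int[mu]_(x in D) g x.
Proof.
move=> mD f0 g0 [N [mN muN0 Nfg]].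
rewrite !ge0_integralE//; apply: ge_ereal_sup => _ [h /= hf <-].
pose h' := proj_nnsfun h (measurableC mN).
have h'E : (h' : T -> R) = h \_ (~` N) by rewrite (mrestrict h (measurableC mN)).
apply: ereal_sup_ubound; exists h' => [x|].
  rewrite h'E.
  have g'0 : 0 <= (g \_ D) x by rewrite patchE; case: ifPn => // /set_mem/g0.
  rewrite {1}/patch; case: ifPn => // /set_mem xN.
  rewrite (le_trans (hf x))// !patchE; case: ifPn => // /set_mem Dx.
  by apply: contrapT => nfg; apply/xN/Nfg => /= /(_ Dx).
rewrite -!integralT_nnsfun [RHS](ge0_negligible_integral mN)//.
- rewrite setTD [RHS]integral_mkcond; apply: eq_integral => x _.
  by rewrite h'E !patchE; case: ifPn.
- exact/measurable_EFinP.
- by move=> x _; rewrite lee_fin.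
Qed.

End IntegralOfArbitraryFunctions.

(** * Simple functions and their integrals *)

Section SimpleFunctions.
Context {R : realType}.
Local Notation mu := (@lebesgue_measure R).
Implicit Types Y Z : completeNormedModType R.

(** Only finitely many pairs of values occur, so the set is a finite union of intersections of level
    sets, whatever [P] is. *)
Lemma simple_preimage2 Y1 Y2 (s1 : R -> Y1) (s2 : R -> Y2) (P : Y1 -> Y2 -> Prop) :
  simple_function s1 -> simple_function s2 ->
  measurable ([set r | P (s1 r) (s2 r)] : set (measurableTypeR R)).
Proof.
move=> [f1 m1] [f2 m2].
pose A := (range s1 `*` range s2) `&` [set ab | P ab.1 ab.2].
rewrite (_ : mkset _ = \bigcup_(ab in A)
    (s1 @^-1` [set ab.1] `&` s2 @^-1` [set ab.2])).
  apply: fin_bigcup_measurable => [|ab _]; last exact: measurableI.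
  exact/finite_setIl/finite_setX.
apply/seteqP; split => [r Pr|r [ab [_ Pab] /= [-> ->]]//].
by exists (s1 r, s2 r) => //; split=> //; split; exists r.
Qed.

Lemma simple_op2 Y1 Y2 Z (op : Y1 -> Y2 -> Z) (s1 : R -> Y1) (s2 : R -> Y2) :
  simple_function s1 -> simple_function s2 ->
  simple_function (fun r => op (s1 r) (s2 r)).
Proof.
move=> h1 h2; split.
  apply: (sub_finite_set _ (finite_image2 op h1.1 h2.1)) => _ [r _ <-].
  by exists (s1 r); [exists r|exists (s2 r); [exists r|]].
by move=> y; exact: (simple_preimage2 (fun a b => op a b = y)).
Qed.

Lemma measurable_normB_simple Y (s1 s2 : R -> Y) :
  simple_function s1 -> simple_function s2 ->
  measurable_fun [set: measurableTypeR R] (fun r => `|s1 r - s2 r|).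
Proof.
move=> h1 h2 _ A mA; rewrite setTI.
exact: (simple_preimage2 (fun a b => A `|a - b|)).
Qed.

Lemma simple_if Y (P : pred R) (s : R -> Y) :
  measurable ([set r | P r] : set (measurableTypeR R)) ->
  simple_function s -> simple_function (fun r => if P r then s r else 0).
Proof.
move=> mP [fs ms]; split.
  apply: (@sub_finite_set _ _ (range s `|` [set 0])).
    move=> _ [r _ <-]; case: ifP => _; last by right.
    by left; exists r.
  by rewrite finite_setU; split => //; exact: finite_set1.
move=> y; rewrite (_ : _ @^-1` _ = ([set r | P r] `&` s @^-1` [set y]) `|`
    (~` [set r | P r] `&` [set _ | 0 = y])).
  apply: measurableU; first exact: measurableI.
  apply: measurableI; first exact: measurableC.
  have [e|ne] := pselect (0 = y).
    by rewrite (_ : mkset _ = setT); [exact: measurableT|apply/seteqP; split].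
  by rewrite (_ : mkset _ = set0); [exact: measurable0|apply/seteqP; split].
apply/seteqP; split => r /=.
  by case: ifPn => [?|/negP Pr] ?; [left|right].
by move=> [[-> //]|[/negP/negbTE -> //]].
Qed.

Lemma simple_shift Y (a : R) (s : R -> Y) :
  simple_function s -> simple_function (fun r => s (r + a)).
Proof.
move=> [fs ms]; split.
  by apply: (sub_finite_set _ fs) => _ [r _ <-]; exists (r + a).
move=> y; have mf : measurable_fun [set: measurableTypeR R]
    ((fun r => r + a) : _ -> measurableTypeR R) by exact: measurable_funD.
by have := mf measurableT _ (ms y); rewrite setTI.
Qed.

Definition clip_measure t (A : set R) : R := fine (mu (`[0, t]%classic `&` A)).

Lemma clip_measureE t (A : set R) : measurable (A : set (measurableTypeR R)) ->
  (clip_measure t A)%:E = mu (`[0, t]%classic `&` A).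
Proof.
move=> mA; rewrite fineK// ge0_fin_numE ?measure_ge0//.
have m0t : measurable (`[0, t]%classic : set (measurableTypeR R)) by [].
apply: (@le_lt_trans _ _ (mu `[0, t]%classic)).
  by apply: le_measure => //; apply/mem_set => //; exact: measurableI.
by rewrite lebesgue_measure_itv/=; case: ifPn => // _; rewrite -EFinD ltry.
Qed.

(** An index set independent of [s] lets integrals of functions with different ranges be compared
    term by term; values not attained have empty level sets. *)
Lemma simple_integralE Y t (s : R -> Y) :
  simple_integral t s = \sum_(y \in setT) clip_measure t (s @^-1` [set y]) *: y.
Proof.
apply: fsbig_widen => // y [_ sy] /=.
rewrite /clip_measure (_ : s @^-1` _ = set0) ?setI0 ?measure0 ?scale0r//.
by apply/seteqP; split => // r /= sr; apply: sy; exists r.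
Qed.

(* The integral may be computed over the level sets of any p through which s
   factors; two integrals are compared over a common p. *)
Lemma simple_integral_refine Y (K : choiceType) t (p : R -> K) (phi : K -> Y) :
  finite_set (range p) ->
  (forall k, measurable (p @^-1` [set k] : set (measurableTypeR R))) ->
  simple_integral t (phi \o p) =
  \sum_(k <- fset_set (range p)) clip_measure t (p @^-1` [set k]) *: phi k.
Proof.
move=> fp mp; set P := fset_set _.
have fs : finite_set (range (phi \o p)).
  apply: (sub_finite_set _ (finite_image phi fp)) => _ [r _ <-].
  by exists (p r) => //; exists r.
rewrite /simple_integral fsbig_finite//=; set S := fset_set _.
have msp y : measurable ((phi \o p) @^-1` [set y] : set (measurableTypeR R)).
  rewrite (_ : _ @^-1` _ = \bigcup_(k in range p `&` [set k | phi k = y]) p @^-1` [set k]).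
    by apply: fin_bigcup_measurable => //; exact: finite_setIl.
  apply/seteqP; split => [r /= pr|r [k [_ /= <-]] /= <- //].
  by exists (p r) => //; split => //; exists r.
(* Additivity of the measure over the finite partition into level sets of [p]. *)
have splitE A : measurable (A : set (measurableTypeR R)) ->
    clip_measure t A = \sum_(k <- P) clip_measure t (A `&` p @^-1` [set k]).
  move=> mA; apply: EFin_inj; rewrite -sumEFin clip_measureE//.
  rewrite (eq_bigr (fun k => mu (`[0, t]%classic `&` (A `&` p @^-1` [set k])))); last first.
    by move=> k _; apply: clip_measureE; apply: measurableI.
  rewrite -fsbig_finite//= -measure_fin_bigcup//.
  - congr mu; apply/seteqP; split => [r [? ?]|r [k _ [? []]]//].
    by exists (p r) => //; exists r.
  - by move=> k l _ _ [r [[_ [_ /= <-]] [_ [_ /= <-]]]].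
  - by move=> k _; apply: measurableI => //; exact: measurableI.
transitivity (\sum_(y <- S) \sum_(k <- P)
    clip_measure t ((phi \o p) @^-1` [set y] `&` p @^-1` [set k]) *: y).
  by apply: eq_bigr => y _; rewrite -/(clip_measure _ _) splitE// scaler_suml.
(* For fixed [k], the level set of [p] at [k] meets that of [phi \o p] at [y] only if [y = phi k],
   so one inner term survives. *)
rewrite exchange_big/=; apply: eq_big_seq => k.
rewrite in_fset_set// => /set_mem[r _ prk].
have kS : phi k \in S by rewrite in_fset_set//; apply/mem_set; exists r; rewrite //= prk.
rewrite (bigD1_seq (phi k)) ?fset_uniq//= big1_seq ?addr0.
  congr (clip_measure _ _ *: _).
  by apply/seteqP; split => [q []//|q /= qk]; rewrite qk.
move=> y /andP[yk _]; rewrite (_ : _ `&` _ = set0).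
  by rewrite /clip_measure setI0 measure0 scale0r.
by apply/seteqP; split => // q [/= qy qk]; move/eqP: yk; apply; rewrite -qk.
Qed.

Lemma simple_integral_linear Y t c (s1 s2 : R -> Y) :
  simple_function s1 -> simple_function s2 ->
  simple_integral t (fun r => c *: s1 r + s2 r) =
  c *: simple_integral t s1 + simple_integral t s2.
Proof.
move=> h1 h2; pose p r := (s1 r, s2 r).
have fp : finite_set (range p).
  apply: (sub_finite_set _ (finite_setX h1.1 h2.1)) => _ [r _ <-].
  by split; exists r.
have mp k : measurable (p @^-1` [set k] : set (measurableTypeR R)).
  exact: (simple_preimage2 (fun a b => (a, b) = k)).
rewrite (simple_integral_refine t (fun k => c *: k.1 + k.2) fp mp).
rewrite (simple_integral_refine t fst fp mp) (simple_integral_refine t snd fp mp).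
rewrite scaler_sumr -big_split; apply: eq_bigr => k _ /=.
by rewrite scalerDr !scalerA mulrC.
Qed.

Lemma norm_simple_integral_le Y t (s : R -> Y) : simple_function s ->
  (`|simple_integral t s|%:E <= \int[mu]_(r in `[0%R, t]) `|s r|%:E)%E.
Proof.
move=> [fs ms]; rewrite (simple_integral_refine t id fs ms).
set S := fset_set _.
(* At each [r] only the term [y = s r] is nonzero; the integral becomes a finite sum over level
   sets, to which the triangle inequality applies. *)
rewrite (eq_integral (fun r : measurableTypeR R =>
    \sum_(y <- S) `|y|%:E * (\1_(s @^-1` [set y]) r)%:E)%E); last first.
  move=> r _; rewrite (bigD1_seq (s r)) ?fset_uniq//=; last first.
    by rewrite in_fset_set//; apply/mem_set; exists r.
  rewrite indicE mem_set//= mule1 big1 ?adde0// => y ysr.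
  by rewrite indicE memNset ?mule0//= => e; rewrite e eqxx in ysr.
rewrite ge0_integral_sum//; last first.
  by move=> y; apply/measurable_EFinP; exact: measurable_funM.
apply: (@le_trans _ _ (\sum_(y <- S) `|clip_measure t (s @^-1` [set y]) *: y|%:E)%E).
  by rewrite sumEFin lee_fin; exact: ler_norm_sum.
apply: lee_sum => y _; rewrite ge0_integralZl//; last first.
  by apply/measurable_EFinP.
rewrite integral_indic// setIC.
rewrite [X in (_ * X)%E](_ : _ = (clip_measure t (s @^-1` [set y]))%:E); last first.
  by apply/esym; exact: clip_measureE.
rewrite -EFinM lee_fin normrZ mulrC.
by rewrite ger0_norm// fine_ge0.
Qed.

End SimpleFunctions.

(** * Linearity and uniqueness of the Bochner integral; translation invariance of Lebesgue
    measure *)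

Section BochnerIntegral.
Context {R : realType}.
Local Notation mu := (@lebesgue_measure R).
Implicit Types Y : completeNormedModType R.

(* Not inferred from ae_filter_ringOfSetsType, whose measure argument is not
   recovered from the function lebesgue_measure. *)
#[global] Instance lebesgue_ae_filter : Filter (almost_everywhere mu).
Proof. by have F := ae_filter_ringOfSetsType mu; exact: F. Qed.

Lemma ae_eq_integral_ge0 (D : set R) (f g : R -> \bar R) :
  measurable (D : set (measurableTypeR R)) ->
  (forall r, D r -> (0 <= f r)%E) -> (forall r, D r -> (0 <= g r)%E) ->
  {ae mu, forall r, D r -> f r = g r} ->
  (\int[mu]_(r in D) f r = \int[mu]_(r in D) g r)%E.
Proof.
move=> mD f0 g0 fg; apply/eqP; rewrite eq_le; apply/andP; split.
  by apply: ae_le_integral_ge0 => //; apply: filterS fg => r fgr /fgr ->.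
by apply: ae_le_integral_ge0 => //; apply: filterS fg => r fgr /fgr ->.
Qed.

(** Additivity and change of variables need measurable integrands, while the distance from [g] to
    [s] is only almost everywhere a limit of measurable functions. The upper limit is measurable and
    defined even where the approximation diverges. *)
Lemma measurable_dist_simple Y (D : set R) (g s : R -> Y) :
  strongly_measurable D g -> simple_function s ->
  exists G : R -> \bar R, [/\ measurable_fun [set: measurableTypeR R] G,
    forall r, (0 <= G r)%E &
    {ae mu, forall r, D r -> G r = `|g r - s r|%:E}].
Proof.
move=> [s' hs' s'g] hs.
exists (fun r => `|limn_esup (fun n => `|s' n r - s r|%:E)|%E); split => //.
  apply: measurableT_comp => //; apply: measurable_fun_limn_esup => n.
  by apply/measurable_EFinP; exact: measurable_normB_simple.
apply: filterS s'g => r s'gr /s'gr {}s'gr.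
have /cvg_limn_einf_sup[_ ->] : `|s' n r - s r|%:E @[n --> \oo] --> `|g r - s r|%:E.
  apply: cvg_EFin; first exact: nearW.
  by apply: cvg_norm; apply: cvgB => //; exact: cvg_cst.
by rewrite gee0_abs ?lee_fin.
Qed.

Lemma integral_dist_linear_le Y (D : set R) c (g1 g2 s1 s2 : R -> Y) :
  measurable (D : set (measurableTypeR R)) ->
  strongly_measurable D g1 -> strongly_measurable D g2 ->
  simple_function s1 -> simple_function s2 ->
  (\int[mu]_(r in D) `|(c *: g1 r + g2 r) - (c *: s1 r + s2 r)|%:E <=
   `|c|%:E * \int[mu]_(r in D) `|g1 r - s1 r|%:E +
   \int[mu]_(r in D) `|g2 r - s2 r|%:E)%E.
Proof.
move=> mD hg1 hg2 hs1 hs2.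
have [G1 [mG1 G1ge0 G1E]] := measurable_dist_simple hg1 hs1.
have [G2 [mG2 G2ge0 G2E]] := measurable_dist_simple hg2 hs2.
have <- : (\int[mu]_(r in D) G1 r = \int[mu]_(r in D) `|g1 r - s1 r|%:E)%E.
  exact: ae_eq_integral_ge0.
have <- : (\int[mu]_(r in D) G2 r = \int[mu]_(r in D) `|g2 r - s2 r|%:E)%E.
  exact: ae_eq_integral_ge0.
have mG1D := measurable_funTS (D := D) mG1.
have mG2D := measurable_funTS (D := D) mG2.
rewrite -ge0_integralZl// -ge0_integralD//; last 2 first.
- by move=> r _; exact: mule_ge0.
- exact: measurable_funeM.
apply: ae_le_integral_ge0 => // [r Dr|].
  by rewrite adde_ge0// mule_ge0.
apply: filterS2 G1E G2E => r G1r G2r Dr.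
rewrite G1r// G2r// -EFinM -EFinD lee_fin -normrZ.
by rewrite opprD addrACA -scalerBr ler_normD.
Qed.

Lemma strongly_measurable_linear Y (D : set R) c (g1 g2 : R -> Y) :
  strongly_measurable D g1 -> strongly_measurable D g2 ->
  strongly_measurable D (fun r => c *: g1 r + g2 r).
Proof.
move=> [s1 hs1 c1] [s2 hs2 c2]; exists (fun n r => c *: s1 n r + s2 n r).
  by move=> n; exact: (simple_op2 (fun a b => c *: a + b)).
apply: filterS2 c1 c2 => r h1 h2 Dr; apply: cvgD; last exact: h2.
by apply: cvgZr; exact: h1.
Qed.

Lemma bochner_integral_linear Y t c (g1 g2 : R -> Y) v1 v2 :
  bochner_integral t g1 v1 -> bochner_integral t g2 v2 ->
  bochner_integral t (fun r => c *: g1 r + g2 r) (c *: v1 + v2).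
Proof.
move=> [m1 [s1 [hs1 i1 l1]]] [m2 [s2 [hs2 i2 l2]]].
split; first exact: strongly_measurable_linear.
exists (fun n r => c *: s1 n r + s2 n r); split.
- by move=> n; exact: (simple_op2 (fun a b => c *: a + b)).
- apply: (@squeeze_cvge _ _ _ _ (cst 0%E) _ (fun n => `|c|%:E *
      \int[mu]_(r in `[0%R, t]) `|g1 r - s1 n r|%:E +
      \int[mu]_(r in `[0%R, t]) `|g2 r - s2 n r|%:E)%E).
  + apply: nearW => n; rewrite integral_ge0/=.
      exact: integral_dist_linear_le.
    by move=> r _; rewrite lee_fin.
  + exact: cvg_cst.
  + rewrite -[X in _ --> X]adde0; apply: cvgeD => //.
    by rewrite -(mule0 `|c|%:E); apply: cvgeZl.
- rewrite (_ : (fun n => _) =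
      (fun n => c *: simple_integral t (s1 n) + simple_integral t (s2 n))).
    by apply: cvgD => //; exact: cvgZr.
  by apply/funext => n; exact: simple_integral_linear.
Qed.

Lemma bochner_integralZ Y t c (g : R -> Y) v :
  bochner_integral t g v -> bochner_integral t (fun r => c *: g r) (c *: v).
Proof.
(* Writing c g as (c - 1) g + g avoids integrating the zero function separately. *)
move=> h; have := bochner_integral_linear (c - 1) h h.
rewrite -{2}(scale1r v) -scalerDl subrK; congr bochner_integral.
by apply/funext => r; rewrite -{2}(scale1r (g r)) -scalerDl subrK.
Qed.

Lemma bochner_integralB Y t (g1 g2 : R -> Y) v1 v2 :
  bochner_integral t g1 v1 -> bochner_integral t g2 v2 ->
  bochner_integral t (fun r => g1 r - g2 r) (v1 - v2).
Proof.
move=> h1 h2; have := bochner_integral_linear (-1) h2 h1.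
rewrite scaleN1r addrC; congr bochner_integral.
by apply/funext => r; rewrite scaleN1r addrC.
Qed.

(** The integrals of the approximants [s n] are bounded in norm by the integrals of [|0 - s n|],
    which tend to 0. By linearity this yields uniqueness of the integral. *)
Lemma bochner_integral0_eq0 Y t (v : Y) :
  bochner_integral t (fun=> 0) v -> v = 0.
Proof.
move=> [_ [s [hs i0 lv]]]; apply/normr0_eq0.
have S0 : `|simple_integral t (s n)|%:E @[n --> \oo] --> 0%:E.
  apply: (@squeeze_cvge _ _ _ _ (cst 0%E) _
    (fun n => \int[mu]_(r in `[0%R, t]) `|0 - s n r|%:E)%E) => //.
    apply: nearW => n; rewrite lee_fin normr_ge0/=.
    under eq_integral do rewrite sub0r normrN.
    exact: norm_simple_integral_le.
  exact: cvg_cst.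
have /fine_cvgP[_ {}S0] := S0.
by apply: (cvg_unique _ (cvg_norm lv) S0).
Qed.

Lemma bochner_integral_unique Y t (g : R -> Y) v v' :
  bochner_integral t g v -> bochner_integral t g v' -> v = v'.
Proof.
move=> h h'; apply/eqP; rewrite -subr_eq0; apply/eqP.
apply: (@bochner_integral0_eq0 _ t).
have := bochner_integralB h h'.
by congr bochner_integral; apply/funext => r; rewrite subrr.
Qed.

Lemma bochner_integral_at0 Y (g : R -> Y) v : bochner_integral 0 g v -> v = 0.
Proof.
move=> [_ [s [hs _ lv]]]; apply: (cvg_unique (@norm_hausdorff _ Y) lv); rewrite /mkset.
have -> : (fun n => simple_integral 0 (s n)) = cst 0; last exact: cvg_cst.
apply/funext => n; apply: fsbig1 => y _.
have [->|y0] := eqVneq y 0; first by rewrite scaler0.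
rewrite -/(clip_measure 0 _) (_ : clip_measure _ _ = 0) ?scale0r//.
rewrite /clip_measure (@subset_measure0 _ _ _ mu _ `[0, 0]%classic)//.
- by apply: measurableI => //; exact: (hs n).2.
- by have := @lebesgue_measure_itv R `[0, 0]; rewrite /= ltxx.
Qed.

(** The pushforward by a translation agrees with Lebesgue measure on half-open intervals, and these
    determine the measure. *)
Lemma lebesgue_measure_shift (a : R) (A : set R) :
  measurable (A : set (measurableTypeR R)) ->
  mu ((fun r => r - a) @^-1` A) = mu A.
Proof.
move=> mA.
have mf : measurable_fun [set: measurableTypeR R]
    ((fun r => r - a) : _ -> measurableTypeR R) by exact: measurable_funB.
pose f : {mfun _ >-> _} :=
  HB.pack ((fun r => r - a) : measurableTypeR R -> measurableTypeR R)
    (isMeasurableFun.Build _ _ _ _ _ mf).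
apply/esym; rewrite -/(pushforward mu (f : _ -> measurableTypeR R) A).
apply: lebesgue_measure_unique => //= _ [[p q]] _ <-.
rewrite /pushforward (_ : _ @^-1` _ = `](p + a), (q + a)]%classic).
  by rewrite !lebesgue_measure_itv/= !lte_fin ltrD2r -!EFinB opprD addrACA subrr addr0.
by apply/seteqP; split => r /=; rewrite !in_itv/= ltrBrDr lerBlDr.
Qed.

Lemma ae_shift (a : R) (P : R -> Prop) :
  {ae mu, forall r, P r} -> {ae mu, forall r, P (r - a)}.
Proof.
move=> [N [mN N0 NP]]; exists ((fun r => r - a) @^-1` N); split.
- have mf : measurable_fun [set: measurableTypeR R]
    ((fun r => r - a) : _ -> measurableTypeR R) by exact: measurable_funB.
  by have := mf measurableT _ mN; rewrite setTI.
- by rewrite -N0; exact: lebesgue_measure_shift.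
- by move=> r /= nP; apply: NP.
Qed.

End BochnerIntegral.

(** * Delaying a Bochner integral *)

Section Shift.
Context {R : realType}.
Local Notation mu := (@lebesgue_measure R).
Implicit Types Y : completeNormedModType R.

Lemma simple_delay Y a (s : R -> Y) : simple_function s ->
  simple_function (fun r => if a <= r then s (r - a) else 0).
Proof.
move=> hs; apply: (@simple_if _ _ (fun r => a <= r) (fun r => s (r - a))).
  rewrite (_ : mkset _ = `[a, +oo[%classic)//.
  by apply/seteqP; split => r /=; rewrite in_itv/= andbT.
exact: simple_shift.
Qed.

Lemma simple_integral_delay Y t a (s : R -> Y) : 0 <= a -> simple_function s ->
  simple_integral (t + a) (fun r => if a <= r then s (r - a) else 0) =
  simple_integral t s.
Proof.
move=> a0 hs; rewrite !simple_integralE; apply: eq_fsbigr => y _.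
(* The zero padding before [a] enlarges only the level set of 0, whose term vanishes; the other
   level sets are merely translated. *)
have [->|y0] := eqVneq y 0; first by rewrite !scaler0.
congr (fine _ *: _).
transitivity (mu ((fun r => r - a) @^-1` (`[0, t]%classic `&` s @^-1` [set y]))); last first.
  by apply: lebesgue_measure_shift; apply: measurableI => //; exact: (hs.2 y).
congr mu; apply/seteqP; split => r /=; rewrite !in_itv/= subr_ge0 lerBlDr.
  move=> [/andP[_ ->]]; case: ifPn => // _ e.
  by rewrite -e eqxx in y0.
by move=> [/andP[ar ->]]; rewrite ar (le_trans a0 ar).
Qed.

(** The change of variables is made on a measurable representative of the distance, extended by 0
    outside [0, t] and integrated over the whole line. An inequality is enough, as the right-hand
    side will tend to 0. *)
Lemma integral_dist_delay_le Y t a (g s : R -> Y) :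
  strongly_measurable `[0, t] g -> simple_function s ->
  (\int[mu]_(r in `[0%R, (t + a)%R])
     `|(if a <= r then g (r - a) else 0) - (if a <= r then s (r - a) else 0)|%:E <=
   \int[mu]_(r in `[0%R, t]) `|g r - s r|%:E)%E.
Proof.
move=> hg hs; have [G [mG G0 GE]] := measurable_dist_simple hg hs.
have <- : (\int[mu]_(r in `[0%R, t]) G r = \int[mu]_(r in `[0%R, t]) `|g r - s r|%:E)%E.
  exact: ae_eq_integral_ge0.
pose H := G \_ `[0, t]%classic.
have mH : measurable_fun [set: measurableTypeR R] H.
  by apply/(measurable_restrictT _ _).1 => //; exact: measurable_funTS mG.
have H0 r : (0 <= H r)%E by apply: erestrict_ge0.
have mf : measurable_fun [set: measurableTypeR R]
    ((fun r => r - a) : _ -> measurableTypeR R) by exact: measurable_funB.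
rewrite [leRHS](_ : _ = \int[mu]_r H (r - a)%R)%E; last first.
  rewrite integral_mkcond.
  have := @ge0_integral_pushforward _ _ _ _ R _ mf mu setT H measurableT mH (fun r _ => H0 r).
  rewrite preimage_setT => <-; apply: eq_measure_integral => A mA _.
  by apply/esym; exact: lebesgue_measure_shift.
rewrite integral_mkcond; apply: ae_le_integral_ge0 => //.
  by move=> r _; apply: erestrict_ge0.
apply: filterS (ae_shift a GE) => r GEr _; rewrite patchE.
case: ifPn => // /set_mem; rewrite /= in_itv/= => /andP[r0 rta].
case: ifPn => ar; last by rewrite subrr normr0.
have rat : `[0, t]%classic (r - a) by rewrite /= in_itv/= subr_ge0 ar lerBlDr.
by rewrite -GEr// /H patchE mem_set.
Qed.

Lemma strongly_measurable_delay Y t a (g : R -> Y) :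
  strongly_measurable `[0, t] g ->
  strongly_measurable `[0, t + a] (fun r => if a <= r then g (r - a) else 0).
Proof.
move=> [s hs sg]; exists (fun n r => if a <= r then s n (r - a) else 0).
  by move=> n; exact: simple_delay.
apply: filterS (ae_shift a sg) => r sgr; rewrite /= in_itv/= => /andP[r0 rta].
case: ifPn => ar; last exact: cvg_cst.
by apply: sgr; rewrite /= in_itv/= subr_ge0 ar lerBlDr.
Qed.

Lemma bochner_integral_delay Y t a (g : R -> Y) v : 0 <= a ->
  bochner_integral t g v ->
  bochner_integral (t + a) (fun r => if a <= r then g (r - a) else 0) v.
Proof.
move=> a0 [mg [s [hs i0 lv]]]; split; first exact: strongly_measurable_delay.
exists (fun n r => if a <= r then s n (r - a) else 0); split.
- by move=> n; exact: simple_delay.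
- apply: (@squeeze_cvge _ _ _ _ (cst 0%E) _
    (fun n => \int[mu]_(r in `[0%R, t]) `|g r - s n r|%:E)%E) => //; last exact: cvg_cst.
  apply: nearW => n; rewrite integral_ge0/=; last by move=> r _; rewrite lee_fin.
  exact: integral_dist_delay_le.
- by under eq_fun do rewrite simple_integral_delay//.
Qed.

End Shift.

(** * Essential bounds and closure properties of locally essentially bounded functions *)

Section EssentialBounds.
Context {R : realType}.
Local Notation mu := (@lebesgue_measure R).
Implicit Types Y : completeNormedModType R.

(** Outside [D] the restriction takes the default value [point], whose norm therefore has to be
    bounded as well. *)
Lemma Linf_norm_le Y (D : set R) (u : R -> Y) M : `|point : Y| <= M ->
  {ae mu, forall r, D r -> `|u r| <= M} -> (Linf_norm D u <= M%:E)%E.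
Proof.
move=> pM uM; apply/ess_supP; apply: filterS uM => r uM.
by rewrite lee_fin patchE; case: ifPn => // /set_mem/uM.
Qed.

Lemma Linf_norm_ge Y (D : set R) (u : R -> Y) :
  {ae mu, forall r, D r -> (`|u r|%:E <= Linf_norm D u)%E}.
Proof.
apply: filterS (ess_sup_ge mu (fun r => `|(u \_ D) r|%:E)) => r h Dr.
by move: h; rewrite patchE mem_set.
Qed.

(** Finiteness is insensitive to the default value [point], so the closure properties below go
    through almost everywhere bounds. *)
Lemma Linf_norm_ltyP Y (D : set R) (u : R -> Y) :
  (Linf_norm D u < +oo)%E <-> exists M, {ae mu, forall r, D r -> `|u r| <= M}.
Proof.
split=> [/ess_supr_bounded[M uM]|[M uM]].
  by exists M; apply: filterS uM => r h Dr; move: h; rewrite patchE mem_set.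
apply: (@le_lt_trans _ _ (Num.max `|point : Y| M)%:E); last exact: ltry.
apply: Linf_norm_le; first by rewrite le_max lexx.
by apply: filterS uM => r h /h uM; rewrite le_max uM orbT.
Qed.

Lemma Linf_locB Y (u1 u2 : R -> Y) :
  Linf_loc u1 -> Linf_loc u2 -> Linf_loc (fun r => u1 r - u2 r).
Proof.
move=> [m1 b1] [m2 b2]; split.
  have := strongly_measurable_linear (-1) m2 m1; congr strongly_measurable.
  by apply/funext => r; rewrite scaleN1r addrC.
move=> t t0; have /Linf_norm_ltyP[M1 h1] := b1 t t0.
have /Linf_norm_ltyP[M2 h2] := b2 t t0; apply/Linf_norm_ltyP; exists (M1 + M2).
apply: filterS2 h1 h2 => r h1 h2 Dr.
by rewrite (le_trans (ler_normB _ _))// lerD ?h1 ?h2.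
Qed.

Lemma Linf_locZ Y c (u : R -> Y) : Linf_loc u -> Linf_loc (fun r => c *: u r).
Proof.
move=> [mu1 b]; split.
  have := strongly_measurable_linear (c - 1) mu1 mu1; congr strongly_measurable.
  by apply/funext => r; rewrite -{2}(scale1r (u r)) -scalerDl subrK.
move=> t t0; have /Linf_norm_ltyP[M h] := b t t0.
apply/Linf_norm_ltyP; exists (`|c| * M); apply: filterS h => r h Dr.
by rewrite normrZ ler_wpM2l ?h.
Qed.

Lemma Linf_loc_translate Y a (u : R -> Y) : 0 <= a ->
  Linf_loc u -> Linf_loc (fun r => u (r + a)).
Proof.
move=> a0 [[s hs su] b]; split.
  exists (fun n r => s n (r + a)); first by move=> n; exact: simple_shift.
  apply: filterS (ae_shift (- a) su) => r; rewrite opprK /= !in_itv/= !andbT.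
  by move=> h r0; apply: h; exact: addr_ge0.
move=> t t0; have /Linf_norm_ltyP[M h] := b (t + a) (addr_ge0 t0 a0).
apply/Linf_norm_ltyP; exists M; apply: filterS (ae_shift (- a) h) => r.
rewrite opprK /= !in_itv/= => {}h /andP[r0 rt].
by apply: h; rewrite addr_ge0// lerD2r.
Qed.

Lemma Linf_loc_suffix Y a (u : R -> Y) :
  Linf_loc u -> Linf_loc (fun r => if a <= r then u r else 0).
Proof.
move=> [[s hs su] b]; split.
  exists (fun n r => if a <= r then s n r else 0).
    move=> n; apply: (@simple_if _ _ (fun r => a <= r)) => //.
    rewrite (_ : mkset _ = `[a, +oo[%classic)//.
    by apply/seteqP; split => r /=; rewrite in_itv/= andbT.
  apply: filterS su => r su r0; case: ifP => _; last exact: cvg_cst.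
  exact: su.
move=> t t0; have /Linf_norm_ltyP[M h] := b t t0.
(* For [t = 0] the interval is null and [M] may be negative. *)
apply/Linf_norm_ltyP; exists (Num.max 0 M); apply: filterS h => r h Dr.
case: ifP => _; first by rewrite le_max h// orbT.
by rewrite normr0 le_max lexx.
Qed.

End EssentialBounds.

(** * Local boundedness of a strongly continuous semigroup *)

Section SemigroupBound.
Context {R : realType} {X : completeNormedModType R}.
Variable T : R -> {linear X -> X}.
Hypothesis hT : C0_semigroup T.

(** Otherwise there are times t_n tending to 0 and vectors x_n with |T(t_n) x_n| > (n + 1) |x_n|.
    Strong continuity makes the T(t_n) pointwise bounded, hence uniformly bounded by
    Banach-Steinhaus, which the normalized x_n contradict. *)
Lemma C0_semigroup_bounded_near0 :
  exists d M, 0 < d /\ forall t x, 0 <= t <= d -> `|T t x| <= M * `|x|.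
Proof.
have [Tc T0 _ Tcvg] := hT.
apply: contrapT => nex.
have /choice[p hp] : forall n : nat, exists p : R * X,
    0 <= p.1 <= n.+1%:R^-1 /\ n.+1%:R * `|p.2| < `|T p.1 p.2|.
  move=> n; apply: contrapT => nexn; apply: nex; exists n.+1%:R^-1, n.+1%:R.
  split; first by rewrite invr_gt0.
  move=> t x tn; rewrite leNgt; apply/negP => ltx.
  by apply: nexn; exists (t, x).
pose t n := (p n).1; pose x n := (p n).2.
(* Strong continuity is a right limit at 0, so the times must be nonzero; at time 0 the operator is
   the identity and cannot expand [x n]. *)
have t_gt0 n : 0 < t n.
  have [/andP[t0 _] tx] := hp n; rewrite lt_neqAle t0 andbT eq_sym.
  apply/eqP => tn0; move: tx; rewrite -/(t n) tn0 T0 ltNge => /negP; apply.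
  by rewrite ler_peMl// ler1n.
have t_cvg0 : t n @[n --> \oo] --> 0.
  apply: (@squeeze_cvgr _ _ _ _ (cst 0) (fun n => n.+1%:R^-1)) => //.
  - by apply: nearW => n; have [] := hp n.
  - exact: cvg_cst.
  - exact: cvg_harmonic.
have t_cvg : t n @[n --> \oo] --> 0^'+.
  move=> A A0; have {}A0 : nbhs 0 [set r | 0 < r -> A r] := A0.
  have tA : \forall n \near \oo, 0 < t n -> A (t n) := t_cvg0 _ A0.
  have : \forall n \near \oo, A (t n) by apply: filterS tA => n; exact.
  by [].
pose F := range (fun n => T (t n) : X -> X).
have /(_ 1)[M FM] : uniform_bounded F.
  apply: Banach_Steinhauss.
    move=> _ [n _ <-]; split; last exact: linearP.
    apply/bounded_funP/linear_bounded_continuous; apply: Tc.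
    exact/ltW/t_gt0.
  move=> y.
  have /cvgP/cvg_seq_bounded : T (t n) y @[n --> \oo] --> y.
    exact: cvg_comp t_cvg (Tcvg y).
  move=> /ex_strict_bound_gt0[M _ yM]; exists M => _ [n _ <-].
  by apply: ltW; exact: yM.
have [n Mn] : exists n, M < n.+1%:R.
  by exists (Num.truncn M); exact: truncnS_gt.
have [_ nx] := hp n.
have x0 : 0 < `|x n|.
  rewrite normr_gt0; apply/eqP => xn0; move: nx.
  by rewrite -/(x n) xn0 linear0 normr0 mulr0 ltxx.
have := FM (T (t n)) (ex_intro2 _ _ n I erefl) (`|x n|^-1 *: x n).
rewrite normrZ normfV normr_id mulVf ?gt_eqF// => /(_ (lexx _)).
rewrite linearZ/= normrZ normfV normr_id ler_pdivrMl// mulrC leNgt => /negP; apply.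
by apply: le_lt_trans nx; rewrite ler_wpM2r// ltW.
Qed.

(** The bound near 0 is iterated by the semigroup law in steps of length [d]; a constant of at least
    1 makes its powers nondecreasing. *)
Lemma C0_semigroup_locally_bounded tau :
  exists2 M, 0 < M & forall t x, 0 <= t <= tau -> `|T t x| <= M * `|x|.
Proof.
have [_ _ TD _] := hT.
have [d [M0 [d0 hM0]]] := C0_semigroup_bounded_near0.
pose M := Num.max 1 M0.
have M1 : 1 <= M by rewrite le_max lexx.
have hM t x : 0 <= t <= d -> `|T t x| <= M * `|x|.
  by move=> /(hM0 _ x)/le_trans; apply; rewrite ler_wpM2r// le_max lexx orbT.
have iterM n t x : 0 <= t <= n%:R * d -> `|T t x| <= M ^+ n.+1 * `|x|.
  elim: n t x => [|n IHn] t x /andP[t0 tn].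
    by apply: hM; rewrite t0 (le_trans tn)// mul0r ltW.
  have [td|/ltW dt] := leP t d.
    apply: (le_trans (hM _ _ _)); first by rewrite t0.
    by rewrite ler_wpM2r// exprS ler_peMr ?(le_trans ler01)// exprn_ege1.
  rewrite -(subrKC d t) TD ?subr_ge0 ?(ltW d0)//.
  apply: (le_trans (hM _ _ _)); first by rewrite lexx ltW.
  rewrite exprS -mulrA ler_wpM2l ?(le_trans ler01)// IHn//.
  by rewrite subr_ge0 dt lerBlDr -{2}(mul1r d) -mulrDl natr1.
(* One more step than the truncated quotient covers [tau]; the other extra factor comes from the
   base case of [iterM]. *)
exists (M ^+ (Num.truncn (tau / d)).+2); first by rewrite exprn_gt0// (lt_le_trans ltr01).
move=> t x /andP[t0 ttau]; apply: iterM; rewrite t0 (le_trans ttau)//.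
by rewrite -ler_pdivrMr// ltW// truncnS_gt.
Qed.

End SemigroupBound.

(** * Estimates for convolutions with the extrapolated semigroup *)

Section ConvolutionBounds.
Context {R : realType} {X Xm1 W : completeNormedModType R}.
Variables (i : {linear X -> Xm1}) (Tm1 : R -> {linear Xm1 -> Xm1}).
Variable (B : {linear W -> Xm1}).
Local Notation mu := (@lebesgue_measure R).

Lemma convolutionB t (w1 w2 : R -> W) z1 z2 :
  convolution Tm1 B t w1 z1 -> convolution Tm1 B t w2 z2 ->
  convolution Tm1 B t (fun s => w1 s - w2 s) (z1 - z2).
Proof.
move=> h1 h2; have := bochner_integralB h1 h2; congr bochner_integral.
by apply/funext => s; rewrite !linearB.
Qed.

Lemma convolutionZ t c (w : R -> W) z :
  convolution Tm1 B t w z -> convolution Tm1 B t (fun s => c *: w s) (c *: z).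
Proof.
move=> h; have := bochner_integralZ c h; congr bochner_integral.
by apply/funext => s; rewrite !linearZ.
Qed.

(** The kernel depends only on the time difference: (t - a) - (s - a) = t - s. *)
Lemma convolution_delay t a (w : R -> W) z : 0 <= a ->
  convolution Tm1 B (t - a) (fun s => w (s + a)) z ->
  convolution Tm1 B t (fun s => if a <= s then w s else 0) z.
Proof.
move=> a0 /(bochner_integral_delay a0); rewrite subrK; congr bochner_integral.
apply/funext => s; case: ifPn => _; last by rewrite !linear0.
by rewrite subrK opprB addrA subrK.
Qed.

Hypothesis i_inj : injective i.
Variable h : R -> R.
Hypothesis h_gt0 : forall t, 0 < t -> 0 < h t.
Hypothesis hP : forall (t : R) w, 0 < t -> Linf_loc w -> exists2 x : X,
  convolution Tm1 B t w (i x) & (`|x|%:E <= (h t)%:E * Linf_norm `[0%R, t] w)%E.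

(** Admissibility provides some element of [X] obeying the estimate; uniqueness of the integral and
    injectivity of [i] identify it with the given [x]. *)
Lemma convolution_bound t (w : R -> W) x b : 0 < t -> 0 <= b -> Linf_loc w ->
  {ae mu, forall r, `[0, t]%classic r -> `|w r| <= b} ->
  convolution Tm1 B t w (i x) -> `|x| <= h t * b.
Proof.
move=> t0 b0 hw wb cwx.
have pos_case b' : 0 < b' ->
    {ae mu, forall r, `[0, t]%classic r -> `|w r| <= b'} -> `|x| <= h t * b'.
  (* Linf_norm is at least the norm of the arbitrary default element point;
     a large dilation makes it harmless. *)
  move=> b'0 wb'; pose p := `|point : W| + 1.
  have p0 : 0 < p by rewrite ltr_wpDl.
  pose l := p / b'; have l0 : 0 < l by rewrite divr_gt0.
  have [y cy] := hP t0 (Linf_locZ l hw).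
  have -> : y = l *: x.
    apply: i_inj; rewrite linearZ/=.
    exact: (bochner_integral_unique cy (convolutionZ l cwx)).
  have lwp : (Linf_norm `[0%R, t] (fun r => l *: w r) <= p%:E)%E.
    apply: Linf_norm_le; first by rewrite lerDl.
    apply: filterS wb' => r wb' /wb' {}wb'.
    by rewrite normrZ (gtr0_norm l0) /l mulrAC ler_pdivrMr// ler_pM2l.
  move=> /le_trans/(_ (lee_wpmul2l _ lwp)).
  rewrite lee_fin ltW ?h_gt0// => /(_ isT); rewrite lee_fin normrZ (gtr0_norm l0).
  have -> : h t * p = l * (h t * b').
    by rewrite mulrCA /l divfK// gt_eqF.
  by rewrite ler_pM2l.
(* Since [b] may be 0, the positive case is applied to [b + e / h t], at the cost of [e]. *)
apply/ler_addgt0Pr => e e0; have ht := h_gt0 t0.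
have be : 0 < b + e / h t by rewrite ltr_wpDl// divr_gt0.
rewrite (le_trans (pos_case _ be _))//.
  by apply: filterS wb => r wb /wb{}wb; rewrite (le_trans wb)// lerDl divr_ge0// ltW.
by rewrite mulrDr mulrCA mulfV ?mulr1// gt_eqF.
Qed.

(** Estimated over the full horizon, the late part would carry the factor [h t]; translating it to
    the origin gives [h (t - a)], which is small for a short late part. *)
Lemma convolution_split_bound t a (w : R -> W) x S b :
  0 <= a -> a < t -> 0 <= S -> 0 <= b -> Linf_loc w ->
  {ae mu, forall r, 0 <= r < a -> `|w r| <= S} ->
  {ae mu, forall r, a <= r <= t -> `|w r| <= b} ->
  convolution Tm1 B t w (i x) -> `|x| <= h t * S + h (t - a) * b.
Proof.
move=> a0 lat S0 b0 hw wS wb cx.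
have t0 := le_lt_trans a0 lat.
have ta0 : 0 < t - a by rewrite subr_gt0.
have hwa := Linf_loc_translate a0 hw.
have [y cy _] := hP ta0 hwa.
have cy' := convolution_delay a0 cy.
(* Here [y] is the contribution of the late part and [x - y] that of the early part. *)
rewrite -(subrK y x) (le_trans (ler_normD _ _))// lerD//.
  apply: (convolution_bound (w := fun s => w s - (if a <= s then w s else 0))) => //.
  - by apply: Linf_locB => //; exact: Linf_loc_suffix.
  - apply: filterS wS => r wS; rewrite /= in_itv/= => /andP[r0 _].
    case: (leP a r) => ar; first by rewrite subrr normr0.
    by rewrite subr0 wS// r0.
  - by rewrite linearB; exact: convolutionB.
apply: (convolution_bound (w := fun s => w (s + a))) => //.
apply: filterS (ae_shift (- a) wb) => r; rewrite opprK.
move=> {}wb; rewrite /= in_itv/= => /andP[r0 rta].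
by apply: wb; rewrite lerDr r0 -lerBrDr.
Qed.

End ConvolutionBounds.

(** * Absorption of half a supremum, and continuity on the half-line *)

(** Taking for [b] the supremum of [e] over [I] gives sup <= A + sup / 2; the bound [b0] only
    ensures that the supremum is finite. *)
Lemma le_double_of_half_absorbed (R : realType) (I : set R) (e : R -> R) A b0 :
  (forall r, 0 <= e r) -> (forall r, I r -> e r <= b0) ->
  (forall b, 0 <= b -> (forall r, I r -> e r <= b) ->
    forall r, I r -> e r <= A + b / 2) ->
  forall r, I r -> e r <= 2 * A.
Proof.
move=> e0 eb0 step r Ir; set E := [set e q | q in I].
have Eub : has_ubound E by exists b0 => _ [q Iq <-]; exact: eb0.
have esup q : I q -> e q <= sup E by move=> Iq; apply: ub_le_sup => //; exists q.
have sup0 : 0 <= sup E := le_trans (e0 r) (esup r Ir).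
have : sup E <= A + sup E / 2.
  by apply: ge_sup => [|_ [q Iq <-]]; [exists (e r); exists r|exact: step].
move=> h; apply: (le_trans (esup r Ir)); lra.
Qed.

(** Mild solutions are continuous on compact intervals, whereas the assumption on [f] takes
    trajectories continuous on the half-line. *)
Lemma continuous_within_itvcy_of_bounded (R : realType) (Y : completeNormedModType R)
    (x : R -> Y) :
  (forall tau, 0 < tau -> {within `[0, tau], continuous x}) ->
  {within `[0, +oo[, continuous x}.
Proof.
move=> xc; apply/continuous_within_itvcyP; split.
  move=> r; rewrite in_itv/= andbT => r0.
  have r10 : 0 < r + 1 by rewrite addr_gt0.
  have /(continuous_within_itvP _ r10)[+ _ _] := xc _ r10.
  by move=> /(_ r); apply; rewrite in_itv/= r0 ltrDl ltr01.
by have /(continuous_within_itvP _ ltr01)[] := xc _ (ltr01 : 0 < 1 :> R).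
Qed.

(** * Initial value and difference of mild solutions *)

Section MildSolutionDifference.
Context {R : realType} {X Xm1 U V : completeNormedModType R}.
Variables (i : {linear X -> Xm1}) (T : R -> {linear X -> X}).
Variable Tm1 : R -> {linear Xm1 -> Xm1}.
Variables (B : {linear U -> Xm1}) (B2 : {linear V -> Xm1}).
Variable f : X -> U -> V.
Hypothesis i_inj : injective i.

Lemma mild_solution_at0 x0 u tau x : T 0 x0 = x0 -> 0 <= tau ->
  mild_solution i T Tm1 B B2 f x0 u tau x -> x 0 = x0.
Proof.
move=> T0 tau0 [_ /(_ 0)]; rewrite lexx tau0 => /(_ isT)[z2 [z [c2 c e]]].
apply: i_inj; rewrite e T0.
by rewrite (bochner_integral_at0 c2) (bochner_integral_at0 c) !addr0.
Qed.

Lemma mild_solutionB x1 x2 u tau y1 y2 t : 0 <= t <= tau ->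
  mild_solution i T Tm1 B B2 f x1 u tau y1 ->
  mild_solution i T Tm1 B B2 f x2 u tau y2 ->
  convolution Tm1 B2 t (fun s => f (y1 s) (u s) - f (y2 s) (u s))
    (i (y1 t - y2 t - T t (x1 - x2))).
Proof.
move=> ht [_ /(_ _ ht)[z1 [z [c1 c e1]]]] [_ /(_ _ ht)[z2 [z' [c2 c' e2]]]].
(* Both solutions have the same integral of the input term, so it cancels. *)
rewrite (bochner_integral_unique c' c) in e2.
rewrite (_ : i _ = z1 - z2); first exact: convolutionB.
rewrite !linearB/= e1 e2 opprK [X in _ - X + _]addrC addrKA addrACA.
by rewrite [_ + z1]addrC addrK opprD [X in _ + X]addrAC addNr add0r.
Qed.

End MildSolutionDifference.

(** * The Lipschitz estimate for the flow *)

Theorem theorem3p23 (R : realType) (X U V : completeNormedModType R)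
  (DA : set X) (A : X -> X) (T : R -> {linear X -> X})
  (hA : generates DA A T)
  (a : R) (Ra : {linear X -> X}) (ha : resolvent DA A a Ra)
  (Xm1 : completeNormedModType R) (i : {linear X -> Xm1})
  (hi : extrapolation_space Ra i)
  (Tm1 : R -> {linear Xm1 -> Xm1}) (hTm1 : extends_semigroup i T Tm1)
  (B : {linear U -> Xm1}) (hB : continuous B)
  (B2 : {linear V -> Xm1}) (hB2 : continuous B2)
  (f : X -> U -> V)
  (* (a) *)
  (hB_adm : infty_admissible i Tm1 B)
  (hPhi : input_map_continuous i Tm1 B)
  (* (b) *)
  (hB2_adm : zero_class_infty_admissible i Tm1 B2)
  (hf_Linf : forall (u : R -> U) (x : R -> X), Linf u ->
    {within `[0, +oo[, continuous x} -> Linf_loc (fun s => f (x s) (u s)))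
  (* (c) *)
  (hf_lip : forall C : R, 0 < C -> exists2 L : R, 0 < L &
    forall (x y : X) (v : U), `|x| < C -> `|y| < C -> `|v| < C ->
      `|f y v - f x v| <= L * `|y - x|)
  (hf_cont : forall x : X, continuous (f x))
  (hf_growth : exists (sigma : R -> R) (c : R),
    [/\ class_Kinfty sigma, 0 < c &
        forall v : U, `|f 0 v| <= sigma `|v| + c])
  (tm : X -> (R -> U) -> \bar R) (phi : X -> (R -> U) -> R -> X)
  (hphi : is_flow i T Tm1 B B2 f tm phi)
  (hFC : forward_complete tm)
  (hBRS : bounded_reachability_sets phi) :
  forall tau C : R, 0 < tau -> 0 < C ->
  exists2 L : R, 0 < L &
    forall (x1 x2 : X) (u : R -> U), `|x1| <= C -> `|x2| <= C ->
      Linf u -> (Linf_norm `[0%R, +oo[ u < C%:E)%E ->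
      forall t : R, 0 <= t <= tau ->
        `|phi x1 u t - phi x2 u t| <= L * `|x1 - x2|.
Proof.
have [_ T0 _ _] := hA.1; have i_inj : injective i.
  move=> x y /eqP; rewrite -subr_eq0 -linearB => /eqP ixy.
  have Rxy : Ra (x - y) = 0 by apply/eqP; rewrite -normr_eq0 -hi.1 ixy normr0.
  (* [A] is a bare function, so A 0 = 0 is read off from the resolvent identity at 0. *)
  have [_ /(_ 0)[_ R0] _] := ha; have [_ /(_ (x - y))[_ Rxy'] _] := ha.
  move: R0; rewrite linear0 => R0.
  by apply/eqP; rewrite -subr_eq0 -Rxy' Rxy R0.
have [h [h_gt0 h_mono hP h_cvg0]] := hB2_adm.
move=> tau C tau0 C0.
have [K0 hK0] := hBRS C tau C0 tau0.
pose K := `|K0|.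
have hK x u t : `|x| <= C -> Linf u -> (Linf_norm `[0%R, +oo[ u < C%:E)%E ->
    0 <= t <= tau -> `|phi x u t| <= K.
  move=> xC hu uC ht; apply: le_trans (ler_norm _); apply: hK0.
  by exists x, u, t; split => //; exact: ltW.
have K_ge0 : 0 <= K by rewrite /K.
(* Strictly above both [K] and [C], because the local Lipschitz condition asks for strict bounds on
   states and inputs. *)
pose C' := K + C + 1; have C'0 : 0 < C' by rewrite /C'; lra.
have [Lf Lf0 hLf] := hf_lip C' C'0.
have [M M0 hM] := C0_semigroup_locally_bounded hA.1 tau.
have [t0 t0_gt0 ht0] : exists2 t0, 0 < t0 & h t0 * Lf <= 2^-1.
  have e0 : 0 < (2 * Lf)^-1 by rewrite invr_gt0 mulr_gt0.
  have /cvgrPdist_le/(_ _ e0) h_small := h_cvg0.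
  have [t [tgt0 ht]] : exists t, 0 < t /\ `|0 - h t| <= (2 * Lf)^-1.
    near (0 : R)^'+ => t; exists t; split; first by near: t; exact: nbhs_right_gt.
    by near: t; exact: h_small.
  exists t => //; move: ht; rewrite sub0r normrN gtr0_norm ?h_gt0// => ht.
  by rewrite -ler_pdivlMr// -invfM.
(* The factor 2 comes from the absorption, [M] from the semigroup acting on the initial difference,
   the [h tau] term from the early part; the summand [c k'] covers times before the current step. *)
pose c := fix c k : R := if k is k'.+1 then
  2 * (c k' + M + h tau * (Lf * c k')) else 1.
have htau := h_gt0 tau tau0.
have c_gt0 k : 0 < c k.
  elim: k => [|k ck] /=; first by [].
  by rewrite mulr_gt0// addr_gt0 ?mulr_gt0// addr_gt0.
exists (c (Num.truncn (tau / t0)).+1) => // x1 x2 u x1C x2C hu uC.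
pose D := `|x1 - x2|; have D0 : 0 <= D by exact: normr_ge0.
pose e t := `|phi x1 u t - phi x2 u t|; have e0 t : 0 <= e t by exact: normr_ge0.
have mild x : mild_solution_upto i T Tm1 B B2 f x u +oo%E (phi x u).
  by have [_ + _] := hphi x u hu; rewrite hFC.
have phi0 x : phi x u 0 = x.
  exact: (mild_solution_at0 i_inj (T0 x) (ltW tau0) (mild x tau tau0 (ltry tau))).
have phi_cont x : {within `[0, +oo[, continuous (phi x u)}.
  apply: continuous_within_itvcy_of_bounded => s s0.
  by have [] := mild x s s0 (ltry _).
pose w s := f (phi x1 u s) (u s) - f (phi x2 u s) (u s).
have hw : Linf_loc w by apply: Linf_locB; exact: hf_Linf.
have we : {ae lebesgue_measure, forall r, 0 <= r <= tau -> `|w r| <= Lf * e r}.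
  apply: filterS (Linf_norm_ge `[0, +oo[%classic u) => r ur rtau.
  have {ur} : (`|u r|%:E < C%:E)%E.
    by apply: le_lt_trans uC; apply: ur; rewrite /= in_itv/= andbT; case/andP: rtau.
  rewrite lte_fin => ur.
  have := hK _ _ _ x1C hu uC rtau; have := hK _ _ _ x2C hu uC rtau => h2 h1.
  by apply: hLf; rewrite /C'; lra.
have step k : (forall t, 0 <= t <= tau -> t <= k%:R * t0 -> e t <= c k * D) ->
    forall t, 0 <= t <= tau -> t <= k.+1%:R * t0 -> e t <= c k.+1 * D.
  move=> IHk; set a0 := k%:R * t0; set S := c k * D.
  have a0_ge0 : 0 <= a0 by rewrite mulr_ge0// ltW.
  have S0 : 0 <= S by rewrite mulr_ge0// ltW.
  pose I := [set t | [/\ 0 <= t <= tau, a0 <= t & t <= k.+1%:R * t0]].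
  pose A0 := S + M * D + h tau * (Lf * S).
  have A0E : 2 * A0 = c k.+1 * D by rewrite /A0 /S /=; ring.
  have absorbed b : 0 <= b -> (forall r, I r -> e r <= b) ->
      forall r, I r -> e r <= A0 + b / 2.
    move=> b0 eb t [/andP[t_ge0 t_tau] at0 tk].
    have MD0 : 0 <= M * D by rewrite mulr_ge0// ltW.
    have hS0 : 0 <= h tau * (Lf * S) by rewrite !mulr_ge0// ltW.
    (* As [a0 <= t] in [I], the first case is [t = a0]: the late part would have length 0, while [h]
       is controlled only at positive times. *)
    have [ta|lat] := leP t a0.
      have : e t <= S by apply: IHk; rewrite ?t_ge0.
      by rewrite /A0; lra.
    set y := phi x1 u t - phi x2 u t - T t (x1 - x2).
    have cy : convolution Tm1 B2 t w (i y).
      apply: (mild_solutionB (B := B) (T := T) (tau := tau)); first by rewrite t_ge0.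
        exact: mild (ltry _).
      exact: mild (ltry _).
    have yb : `|y| <= h t * (Lf * S) + h (t - a0) * (Lf * b).
      apply: (convolution_split_bound i_inj h_gt0 hP a0_ge0 lat _ _ hw) cy.
      - by rewrite mulr_ge0// ltW.
      - by rewrite mulr_ge0// ltW.
      - apply: filterS we => r wr /andP[r0 ra].
        have rtau : 0 <= r <= tau by rewrite r0 (le_trans (ltW ra))// (le_trans (ltW lat)).
        by rewrite (le_trans (wr rtau))// ler_pM2l// IHk// ltW.
      - apply: filterS we => r wr /andP[ar rt].
        have rtau : 0 <= r <= tau by rewrite (le_trans a0_ge0)// (le_trans rt).
        rewrite (le_trans (wr rtau))// ler_pM2l// eb//.
        by split => //; exact: le_trans rt tk.
    have tpos := le_lt_trans a0_ge0 lat.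
    have h1 : h t * (Lf * S) <= h tau * (Lf * S).
      by rewrite ler_wpM2r ?h_mono// mulr_ge0// ltW.
    have h2 : h (t - a0) * (Lf * b) <= b / 2.
      rewrite mulrA mulrC ler_wpM2l//; apply: le_trans ht0.
      rewrite ler_pM2r//; apply: h_mono; first by rewrite subr_gt0.
      by rewrite lerBlDl -{1}(mul1r t0) -mulrDl natr1.
    have Tb : `|T t (x1 - x2)| <= M * D by apply: hM; rewrite t_ge0.
    have : e t <= `|y| + `|T t (x1 - x2)|.
      by rewrite /e -(subrK (T t (x1 - x2)) (_ - _)) ler_normD.
    by rewrite /A0; lra.
  move=> t ht tk; have [ta|/ltW at0] := leP t a0.
    have : e t <= S by exact: IHk.
    have MD0 : 0 <= M * D by rewrite mulr_ge0// ltW.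
    have hS0 : 0 <= h tau * (Lf * S) by rewrite !mulr_ge0// ltW.
    by rewrite -A0E /A0; lra.
  (* The crude bound [K + K] only makes the supremum finite and does not enter the Lipschitz
     constant. *)
  rewrite -A0E; apply: (le_double_of_half_absorbed (b0 := K + K) e0 _ absorbed) => //.
  move=> r [rtau _ _]; rewrite (le_trans (ler_normB _ _))// lerD//.
    exact: hK rtau.
  exact: hK rtau.
have all_steps k t : 0 <= t <= tau -> t <= k%:R * t0 -> e t <= c k * D.
  (* For [k = 0] only [t = 0] remains, where the solutions equal their initial values; hence
     [c 0 = 1]. *)
  elim: k t => [t /andP[t_ge0 _]|k IHk]; last exact: step.
  rewrite mul0r => t_le0; have -> : t = 0 by apply/eqP; rewrite eq_le t_ge0 t_le0.
  by rewrite /e !phi0 mul1r.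
move=> t ht; apply: all_steps => //; case/andP: ht => _ /le_trans; apply.
by rewrite -ler_pdivrMr// ltW// truncnS_gt.
Unshelve. all: by end_near.
Qed.
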